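(* Let $\beta\in(0,1)$ and $\nu\ge 0$. The fractional equation $$\frac{d^\beta}{dt^\beta}\left(t^{\nu}\frac{df}{dt}\right)=\beta\, t^{\nu-1} f(t),$$ involving a fractional derivative in the sense of Caputo of order $\beta$, admits a solution of the form $$f(t)=W_{\beta,\nu}(t^\beta).$$
   Context: The Wright function is the entire function $W_{\lambda,\mu}(z)=\sum_{n=0}^{\infty}\frac{z^n}{n!\,\Gamma(\lambda n+\mu)}$, for $\lambda>-1$, $\mu\in\mathbb{C}$ (with $1/\Gamma$ taken to be $0$ at the poles of $\Gamma$). For $0<\beta<1$ the Caputo fractional derivative of order $\beta$ of a function $g$ of $t$ is $\left(\frac{d^\beta}{dt^\beta}g\right)(t)=\frac{1}{\Gamma(1-\beta)}\int_0^t\frac{g'(\tau)}{(t-\tau)^{\beta}}\,d\tau$. On the left-hand side of the equation it is applied to the function $t\mapsto t^\nu f'(t)$.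
   Formalization: The formal theorem assumes in addition β+ν>1: for β+ν=1 the Caputo derivative kills the constant leading term of t^ν f' and the equation fails, and for β+ν<1 the Caputo integral diverges at 0, so the left side is undefined. *)

(* Defs.v *)
From HB Require Import structures.
From mathcomp Require Import all_boot all_order all_algebra.
From mathcomp Require Import all_classical all_reals all_analysis.

Set Implicit Arguments.
Unset Strict Implicit.
Unset Printing Implicit Defensive.

Import Order.TTheory GRing.Theory Num.Theory.
Import numFieldNormedType.Exports.

Local Open Scope classical_set_scope.
Local Open Scope ring_scope.

(* Euler's integral; it represents Gamma only for 0 < x. *)
Definition euler_gamma (R : realType) (x : R) : R :=
  \int[lebesgue_measure]_(s in `]0, +oo[%classic) (s `^ (x - 1) * expR (- s)).

(* 1 / Gamma at every real x, by the recurrence Gamma (x + 1) = x * Gamma x: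
   k is the least natural number with 0 < x + k, so k = 0 when 0 < x, and at
   the poles x = 0, -1, -2, ... of Gamma the product contains the factor 0. *)
Definition rgamma (R : realType) (x : R) : R :=
  let k := Num.truncn (1 - x) in
  (\prod_(i < k) (x + i%:R)) / euler_gamma (x + k%:R).

Definition wright_coeff (R : realType) (lambda mu : R) (n : nat) : R :=
  rgamma (lambda * n%:R + mu) / n`!%:R.

(* The Wright function with real parameters on the real line.  The limit is
   meaningful only where the series converges. *)
Definition wright (R : realType) (lambda mu z : R) : R :=
  limn (pseries (wright_coeff lambda mu) z).

Definition caputo_integrand (R : realType) (beta : R) (g : R -> R) (t tau : R)
  : R := derive1 g tau / (t - tau) `^ beta.

(* Both [derive1] and the real-valued integral are total, so [caputo] is the
   Caputo derivative only under this condition. *)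
Definition caputo_derivable (R : realType) (beta : R) (g : R -> R) (t : R)
  : Prop :=
  (forall tau, 0 < tau < t -> derivable g tau 1) /\
  (@lebesgue_measure R).-integrable `]0, t[%classic
    (fun tau => (caputo_integrand beta g t tau)%:E).

Definition caputo (R : realType) (beta : R) (g : R -> R) (t : R) : R :=
  (euler_gamma (1 - beta))^-1 *
  \int[lebesgue_measure]_(tau in `]0, t[%classic)
    caputo_integrand beta g t tau.

(* Main.v *)
Require Import Defs.
From HB Require Import structures.
From mathcomp Require Import all_boot all_order all_algebra.
From mathcomp Require Import all_classical all_reals all_analysis.
From mathcomp Require Import measurable_realfun.
From mathcomp Require Import ring lra.

(** The Wright functions satisfy two shift rules in their second parameter,
    and the equation is their composition.  With W_mu standing for
    W_{beta,mu} evaluated at s^beta, and with every parameter positive: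

    - differentiation lowers the parameter by one,
        (s^mu W_{mu+1})' = s^(mu-1) W_mu,
      which is the derivative rule W_{lambda,mu}' = W_{lambda,lambda+mu}
      combined with the contiguous relation
      lambda z W_{lambda,lambda+mu+1} + mu W_{lambda,mu+1} = W_{lambda,mu}
      ([is_derive_powR_wright], [wright_contiguous]);
    - the Riemann-Liouville integral of order b raises it by b,
        int_0^t s^(mu-1) W_mu (t-s)^(b-1) ds = Gamma(b) t^(mu+b-1) W_{mu+b}
      ([integral_powR_wright]).

    For f(t) = W_nu one computes f'(t) = beta t^(beta-1) W_{beta+nu}, hence
    t^nu f'(t) = beta t^m W_{m+1} with m = beta + nu - 1.  The first rule turns
    its derivative into beta t^(m-1) W_m, and the second one with b = 1 - beta
    gives beta Gamma(1-beta) t^(nu-1) W_nu, because m + b = nu.  Since m > 0,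
    all the Gamma arguments that occur are positive, so every term is
    nonnegative and the series is integrated term by term by monotone
    convergence.

    Each term of that series is a Beta integral, so the analytic input is
    Euler's formula B(a,b) = Gamma(a) Gamma(b) / Gamma(a+b)
    ([integral_beta]).  It is obtained by Tonelli's theorem from
    Gamma(a) Gamma(b), integrating first along the lines x + y = s.  Tonelli's
    theorem gives this as an identity between extended reals, so its case
    b = 1 is the recurrence Gamma(a+1) = a Gamma(a) with the value +oo allowed,
    and the finiteness of Gamma on ]0, 1] then extends to every a > 0. *)

Set Implicit Arguments.
Unset Strict Implicit.
Unset Printing Implicit Defensive.

Import Order.TTheory GRing.Theory Num.Theory.
Import numFieldNormedType.Exports.

Local Open Scope classical_set_scope.
Local Open Scope ring_scope.

(** * Affine change of variable *)

(** An affine map rescales Lebesgue measure itself, so the formula holds for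
    every nonnegative measurable integrand, in particular for those that are
    singular like x^(a-1) at 0. *)
Lemma ge0_integral_affine (R : realType) (f : R -> \bar R) (c d : R) : 0 < c ->
  measurable_fun [set: R] f -> (forall x, 0 <= f x)%E ->
  (\int[lebesgue_measure]_x f x =
     c%:E * \int[lebesgue_measure]_x f (c * x + d)%R)%E.
Proof.
move=> c0 mf f0.
pose phi : measurableTypeR R -> measurableTypeR R := fun x => c * x + d.
have mphi : measurable_fun setT phi.
  by apply: measurable_funD => //; exact: measurable_funM.
pose nu : {measure set (measurableTypeR R) -> \bar R} :=
  mscale (NngNum (ltW c0)) (pushforward lebesgue_measure phi).
transitivity (\int[nu mphi]_x f x)%E; last first.
  rewrite ge0_integral_mscale//; congr (_ * _)%E.
  have := ge0_integral_pushforward mphi lebesgue_measure measurableT mf.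
  by move=> ->// x _; exact: f0.
apply: eq_measure_integral => A mA _.
(* It is enough to compare the two measures on half-open intervals. *)
have H := lebesgue_measure_unique (mu := nu mphi).
apply: H => // _ [[a b]] _ <-.
change (lebesgue_measure `]a, b]%classic =
  c%:E * lebesgue_measure (phi @^-1` `]a, b]%classic))%E.
rewrite (_ : _ @^-1` _ = `]((a - d) / c), ((b - d) / c)]%classic); last first.
  apply/seteqP; split => x /=; rewrite !in_itv/= ltr_pdivrMr// ler_pdivlMr//.
    by rewrite ltrBlDr lerBrDr mulrC.
  by rewrite ltrBlDr lerBrDr mulrC.
rewrite !lebesgue_measure_itv/= !lte_fin ltr_pM2r ?invr_gt0// ltrD2r.
case: ifP => _; last by rewrite mule0.
by rewrite -!EFinD -EFinM; congr EFin; field; exact: lt0r_neq0.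
Qed.

(** * The Beta and Gamma integrals in the extended reals *)

(** The truncated power x_+^(a-1).  Its vanishing on x <= 0 encodes the domains
    of both integrals, which thereby become integrals over the whole line: the
    Beta integral is the convolution of two truncated powers. *)
Definition tpow (R : realType) (a x : R) : R :=
  if 0 < x then x `^ (a - 1) else 0.

Lemma tpowE (R : realType) (a x : R) : 0 < x -> tpow a x = x `^ (a - 1).
Proof. by rewrite /tpow => ->. Qed.

Lemma tpow_eq0 (R : realType) (a x : R) : x <= 0 -> tpow a x = 0.
Proof. by rewrite /tpow ltNge => ->. Qed.

Lemma tpow_ge0 (R : realType) (a x : R) : 0 <= tpow a x.
Proof. by rewrite /tpow; case: ifP => // _; exact: powR_ge0. Qed.

Lemma measurable_tpow (R : realType) (a : R) : measurable_fun setT (tpow a).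
Proof.
by apply: measurable_fun_ifT => //; exact: measurable_fun_ltr.
Qed.

Lemma tpowM (R : realType) (a t x : R) : 0 < t ->
  tpow a (t * x) = t `^ (a - 1) * tpow a x.
Proof.
move=> t0; rewrite /tpow pmulr_rgt0//; case: ifPn => [x0|_].
  by rewrite powRM// ltW.
by rewrite mulr0.
Qed.

Definition betaE (R : realType) (a b t : R) : \bar R :=
  (\int[lebesgue_measure]_x (tpow a x * tpow b (t - x))%:E)%E.

Definition gammaE (R : realType) (a : R) : \bar R :=
  (\int[lebesgue_measure]_x (tpow a x * expR (- x))%:E)%E.

Lemma gammaE_ge0 (R : realType) (a : R) : (0 <= gammaE a)%E.
Proof.
by apply: integral_ge0 => x _; rewrite lee_fin mulr_ge0 ?tpow_ge0 ?expR_ge0.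
Qed.

Lemma betaE_ge0 (R : realType) (a b t : R) : (0 <= betaE a b t)%E.
Proof.
by apply: integral_ge0 => x _; rewrite lee_fin mulr_ge0 ?tpow_ge0.
Qed.

Lemma measurable_beta_integrand (R : realType) (a b t : R) :
  measurable_fun setT (fun x => tpow a x * tpow b (t - x)).
Proof.
apply: measurable_funM; first exact: measurable_tpow.
by apply: measurableT_comp; [exact: measurable_tpow|exact: measurable_funB].
Qed.

Lemma measurable_gamma_integrand (R : realType) (a : R) :
  measurable_fun setT (fun x => tpow a x * expR (- x)).
Proof.
apply: measurable_funM; first exact: measurable_tpow.
by apply: measurableT_comp; [exact: measurable_expR|exact: measurable_funN].
Qed.

(** Homogeneity: substitute x = t y.  When t <= 0 the two truncated powers have
    disjoint supports, which is why the factor is again a truncated power. *)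
Lemma betaE_scale (R : realType) (a b t : R) :
  betaE a b t = ((tpow (a + b) t)%:E * betaE a b 1)%E.
Proof.
have [t0|t0] := ltP 0 t; last first.
  rewrite (tpow_eq0 _ t0) mul0e /betaE integral0_eq// => x _.
  have [x0|x0] := leP x 0; first by rewrite tpow_eq0// mul0r.
  by rewrite [tpow b _]tpow_eq0 ?mulr0// subr_le0 (le_trans t0)// ltW.
have mB := measurable_beta_integrand a b.
have B0 u x : (0 <= (tpow a x * tpow b (u - x))%:E)%E.
  by rewrite lee_fin mulr_ge0 ?tpow_ge0.
rewrite (tpowE _ t0) {1}/betaE (@ge0_integral_affine _ _ t 0 t0); last 2 first.
- by apply/measurable_EFinP; exact: mB.
- exact: B0.
rewrite /betaE -[RHS]ge0_integralZl; last 4 first.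
- exact: measurableT.
- by apply/measurable_EFinP; exact: mB.
- by move=> x _; exact: B0.
- by rewrite lee_fin powR_ge0.
rewrite -ge0_integralZl; last 4 first.
- exact: measurableT.
- apply/measurable_EFinP; apply: (measurableT_comp (mB t)).
  by apply: measurable_funD => //; exact: measurable_funM.
- by move=> x _; exact: B0.
- by rewrite lee_fin ltW.
apply: eq_integral => x _; rewrite addr0.
have -> : t - t * x = t * (1 - x) by rewrite mulrBr mulr1.
rewrite !tpowM// -!EFinM; congr EFin.
have tN0 : t != 0 by rewrite gt_eqF.
rewrite (_ : a + b - 1 = 1 + ((a - 1) + (b - 1))); last by ring.
rewrite !powRD ?tN0 ?implybT// powRr1 ?ltW//; ring.
Qed.

(** Tonelli's theorem after the shear (x, y) -> (x, x + y): on the line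
    x + y = s the exponential is the constant e^(-s), and the convolution of
    the two powers is a Beta integral scaled by s^(a+b-1). *)
Lemma gammaE_mul (R : realType) (a b : R) :
  (gammaE a * gammaE b = gammaE (a + b) * betaE a b 1)%E.
Proof.
pose F (z : R * R) := (tpow a z.1 * tpow b (z.2 - z.1) * expR (- z.2))%:E.
have mF : measurable_fun setT F.
  apply/measurable_EFinP; apply: measurable_funM.
    apply: measurable_funM.
      apply: measurableT_comp; first exact: measurable_tpow.
      exact: measurable_fst.
    apply: measurableT_comp; [exact: measurable_tpow|].
    by apply: measurable_funB; [exact: measurable_snd|exact: measurable_fst].
  apply: measurableT_comp; [exact: measurable_expR|].
  by apply: measurable_funN; exact: measurable_snd.
have F0 z : (0 <= F z)%E.
  by rewrite lee_fin !mulr_ge0 ?tpow_ge0 ?expR_ge0.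
transitivity (\int[lebesgue_measure]_x \int[lebesgue_measure]_y F (x, y))%E.
  rewrite {1}/gammaE -ge0_integralZr//; first last.
  - exact: gammaE_ge0.
  - by move=> x _; rewrite lee_fin mulr_ge0 ?tpow_ge0 ?expR_ge0.
  - by apply/measurable_EFinP; exact: measurable_gamma_integrand.
  apply: eq_integral => x _.
  rewrite [RHS](@ge0_integral_affine _ _ 1 x ltr01); last 2 first.
  - exact: measurableT_comp mF _.
  - by move=> y; exact: F0.
  rewrite mul1e /gammaE -ge0_integralZl//; first last.
  - by rewrite lee_fin mulr_ge0 ?tpow_ge0 ?expR_ge0.
  - by move=> y _; rewrite lee_fin mulr_ge0 ?tpow_ge0 ?expR_ge0.
  - by apply/measurable_EFinP; exact: measurable_gamma_integrand.
  apply: eq_integral => y _; rewrite /F/= mul1r addrK -EFinM opprD expRD.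
  by congr EFin; ring.
rewrite fubini_tonelli//.
rewrite /gammaE -ge0_integralZr//; first last.
- exact: betaE_ge0.
- by move=> x _; rewrite lee_fin mulr_ge0 ?tpow_ge0 ?expR_ge0.
- by apply/measurable_EFinP; exact: measurable_gamma_integrand.
apply: eq_integral => y _; rewrite /F/= EFinM muleAC -betaE_scale /betaE.
rewrite -ge0_integralZr//; first last.
- by move=> x _; rewrite lee_fin mulr_ge0 ?tpow_ge0.
- by apply/measurable_EFinP; exact: measurable_beta_integrand.
Qed.

Lemma betaE_itv (R : realType) (a b t : R) : betaE a b t =
  (\int[lebesgue_measure]_(x in `]0%R, t[)
     (x `^ (a - 1) * (t - x) `^ (b - 1))%:E)%E.
Proof.
rewrite integral_mkcond; apply: eq_integral => x _; rewrite patchE.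
case: ifPn => [|/negP]; rewrite in_setE/= in_itv/=.
  by move=> /andP[x0 xt]; rewrite !tpowE// subr_gt0.
move=> /negP; rewrite negb_and -!leNgt => /orP[x0|tx].
  by rewrite tpow_eq0// mul0r.
by rewrite [tpow b _]tpow_eq0 ?mulr0// subr_le0.
Qed.

Lemma gammaE_itv (R : realType) (a : R) : gammaE a =
  (\int[lebesgue_measure]_(x in `]0%R, +oo[)
     (x `^ (a - 1) * expR (- x))%:E)%E.
Proof.
rewrite integral_mkcond; apply: eq_integral => x _; rewrite patchE.
case: ifPn => [|/negP]; rewrite in_setE/= in_itv/= andbT.
  by move=> x0; rewrite tpowE.
by move=> /negP; rewrite -leNgt => x0; rewrite tpow_eq0// mul0r.
Qed.

Lemma integral_powR (R : realType) (a e : R) : 0 < a -> 0 < e < 1 ->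
  (\int[lebesgue_measure]_(x in `[e, 1%R]) (x `^ (a - 1))%:E =
    ((1 - e `^ a) / a)%:E)%E.
Proof.
move=> a0 /andP[e0 e1].
have dpow (p x : R) : e <= x -> derivable (fun y : R => y `^ p) x 1.
  move=> ex; apply: derivable_powR.
  by rewrite in_itv/= andbT; exact: lt_le_trans ex.
have dF x : e <= x -> derivable (fun y : R => y `^ a / a) x 1.
  by move=> ex; apply: derivableM => //; exact: dpow.
have cF x : e <= x -> {for x, continuous (fun y : R => y `^ a / a)}.
  move=> ex; apply: differentiable_continuous.
  by apply/derivable1_diffP; exact: dF.
rewrite (@continuous_FTC2 _ _ (fun x => x `^ a / a))//; last 3 first.
- apply: derivable_within_continuous => x; rewrite in_itv/= => /andP[ex _].
  exact: dpow.
- split.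
  + by move=> x; rewrite in_itv/= => /andP[ex _]; apply: dF; exact: ltW.
  + by apply: cvg_at_right_filter; exact: cF.
  + by apply: cvg_at_left_filter; apply: cF; exact: ltW.
- move=> x; rewrite in_itv/= => /andP[ex _].
  have x0 : 0 < x by exact: lt_trans ex.
  rewrite derive1E deriveM//; last by apply: dpow; exact: ltW.
  have -> : 'D_1 (fun y => y `^ a) x = a * x `^ (a - 1).
    by rewrite -derive1E powR_derive1// in_itv/= x0.
  rewrite derive_cst scaler0 add0r/=.
  by rewrite /GRing.scale/= mulrA mulVf ?mul1r// gt_eqF.
by rewrite powR1 -EFinB mulrBl.
Qed.

(** The integrand is unbounded at 0 when a < 1, so the fundamental theorem is
    applied on [1/(n+2), 1] and followed by monotone convergence. *)
Lemma betaE_1 (R : realType) (a : R) : 0 < a -> betaE a 1 1 = (a^-1)%:E.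
Proof.
move=> a0.
pose F (n : nat) : set R := `[n.+2%:R^-1, 1]%classic.
pose f (x : R) : \bar R := (x `^ (a - 1))%:E.
have mf D : measurable_fun D f.
  by apply/measurable_EFinP; apply: measurable_funTS; exact: measurable_powR.
have Fcup : \bigcup_n F n = `]0, 1]%classic.
  apply/seteqP; split => x /=.
    move=> [n _]; rewrite /F/= !in_itv/= => /andP[nx ->]; rewrite andbT.
    by apply: lt_le_trans nx; rewrite invr_gt0.
  rewrite in_itv/= => /andP[x0 x1].
  have [n nx] := ltr_add_invr x0; exists n => //.
  rewrite /F/= in_itv/= x1 andbT.
  rewrite add0r in nx; apply: le_trans (ltW nx).
  by rewrite lef_pV2 ?posrE// ler_nat.
have : (\int[lebesgue_measure]_(x in F n) f x @[n --> \oo] -->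
        \int[lebesgue_measure]_(x in \bigcup_n F n) f x)%E.
  apply: ge0_nondecreasing_set_cvg_integral => //.
  - apply/nondecreasing_seqP => n; rewrite subsetEset => x.
    rewrite /F/= !in_itv/= => /andP[nx ->]; rewrite andbT.
    by apply: le_trans nx; rewrite lef_pV2 ?posrE// ler_nat.
  - by move=> n; exact: measurable_itv.
  - by move=> n; exact: mf.
  - by move=> n x _; rewrite lee_fin powR_ge0.
have -> : (fun n => \int[lebesgue_measure]_(x in F n) f x)%E =
    (fun n => ((1 - n.+2%:R^-1 `^ a) / a)%:E).
  apply/funext => n; rewrite integral_powR// invr_gt0 ltr0n/=.
  by rewrite invf_lt1// ltr1n.
have lim_ : (1 - n.+2%:R^-1 `^ a) / a @[n --> \oo] --> a^-1.
  rewrite [X in _ --> X](_ : _ = (1 - 0) / a); last by rewrite subr0 mul1r.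
  apply: cvgM; last exact: cvg_cst.
  apply: cvgB; first exact: cvg_cst.
  move/(cvg_at_rightP (fun x : R => x `^ a)): (powR_cvg0 a0); apply; split.
    by move=> n; rewrite invr_gt0.
  have := @cvg_harmonic R; rewrite -(cvg_shiftn 1); apply: cvg_trans.
  by apply: near_eq_cvg; apply: nearW => n; rewrite /harmonic/= addn1.
rewrite Fcup => cvgF.
rewrite betaE_itv (@integral_itv_bndo_bndc _ (BRight 0)); last first.
  apply/measurable_EFinP/measurable_funM; apply: measurable_funTS.
    exact: measurable_powR.
  apply: (measurableT_comp (measurable_powR _)).
  exact: measurable_funB.
transitivity (\int[lebesgue_measure]_(x in `]0%R, 1%R]) f x)%E.
  by apply: eq_integral => x _; rewrite subrr powRr0 mulr1.
apply: cvg_unique cvgF _ => //; apply: cvg_EFin; last exact: lim_.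
exact: nearW.
Qed.

Lemma gammaE_1 (R : realType) : gammaE 1 = 1%E :> \bar R.
Proof.
have mf : measurable_fun setT (fun x : R => expR (- x)).
  by apply: measurableT_comp; [exact: measurable_expR|exact: measurable_funN].
rewrite gammaE_itv -(integral_exponential_pdf (@ltr01 R)).
rewrite integral_itv_obnd_cbnd; last first.
  apply/measurable_EFinP/measurable_funM; apply: measurable_funTS.
    exact: measurable_powR.
  exact: mf.
rewrite integral_mkcond; apply: eq_integral => x _.
rewrite /exponential_pdf /patch; case: ifP => // _.
by rewrite subrr powRr0 !mul1r mulN1r.
Qed.

(** [gammaE_mul] at b = 1, with B(a,1) = 1/a and Gamma(1) = 1.  The identity
    still compares the two values if they are infinite, so it can serve to
    prove that they are finite. *)
Lemma gammaE_recurrence (R : realType) (a : R) : 0 < a ->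
  gammaE a = ((a^-1)%:E * gammaE (a + 1))%E.
Proof.
by move=> a0; rewrite muleC -betaE_1// -gammaE_mul gammaE_1 mule1.
Qed.

(** For a <= 1 the integrand is at most x^(a-1) on ]0, 1[ and at most e^(-x)
    beyond; the recurrence then propagates finiteness to every a. *)
Lemma gammaE_lty (R : realType) (a : R) : 0 < a -> (gammaE a < +oo)%E.
Proof.
move=> a0; have [n an] : exists n : nat, a <= n.+1%:R.
  by exists (Num.truncn a); exact/ltW/truncnS_gt.
elim: n a a0 an => [a a0 a1|n IHn a a0 an].
  apply: (@le_lt_trans _ _ (betaE a 1 1 + gammaE 1)%E); last first.
    by rewrite betaE_1// gammaE_1 -EFinD ltry.
  rewrite -ge0_integralD//; first last.
  - by apply/measurable_EFinP; exact: measurable_gamma_integrand.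
  - by move=> x _; rewrite lee_fin mulr_ge0 ?tpow_ge0 ?expR_ge0.
  - by apply/measurable_EFinP; exact: measurable_beta_integrand.
  - by move=> x _; rewrite lee_fin mulr_ge0 ?tpow_ge0.
  apply: ge0_le_integral => //.
  - by move=> x _; rewrite lee_fin mulr_ge0 ?tpow_ge0 ?expR_ge0.
  - by apply/measurable_EFinP; exact: measurable_gamma_integrand.
  - apply: emeasurable_funD; apply/measurable_EFinP.
      exact: measurable_beta_integrand.
    exact: measurable_gamma_integrand.
  move=> x _; rewrite lee_fin.
  have [x0|x0] := leP x 0.
    by rewrite !(tpow_eq0 _ x0) !mul0r addr0.
  rewrite [tpow 1 x]tpowE// subrr powRr0 mul1r.
  have [x1|x1] := ltP x 1.
    rewrite [tpow 1 _]tpowE ?subr_gt0// subrr powRr0 mulr1.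
    rewrite ler_wpDr ?expR_ge0// ler_piMr ?tpow_ge0//.
    by rewrite -expR0 ler_expR oppr_le0 ltW.
  rewrite ler_wpDl ?mulr_ge0 ?tpow_ge0// ler_piMl ?expR_ge0// tpowE//.
  by rewrite -[leRHS](powRr0 x) ler_powR// subr_le0.
have [a1|a1] := leP a 1.
  by apply: IHn => //; apply: le_trans a1 _; rewrite ler1n.
have a10 : 0 < a - 1 by rewrite subr_gt0.
have := IHn _ a10; rewrite lerBlDr natr1 => /(_ an).
rewrite gammaE_recurrence// subrK.
case: (gammaE a) (gammaE_ge0 a) => [r _ _|_|//]; first exact: ltry.
by rewrite gt0_muley ?ltxx// lte_fin invr_gt0.
Qed.

(** Integrating over [1, 2] only, where x^(a-1) >= 1/x >= 1/2.  The bound does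
    not depend on a, so 1/Gamma is bounded on the positive half-line; this
    makes the Wright series converge by comparison with an exponential. *)
Lemma gammaE_lower_bound (R : realType) (a : R) : 0 < a ->
  ((expR (-2) / 2)%:E <= gammaE a)%E.
Proof.
move=> a0; rewrite gammaE_itv.
have mf D : measurable_fun D (fun x : R => (x `^ (a - 1) * expR (- x))%:E).
  apply/measurable_EFinP/measurable_funM; apply: measurable_funTS.
    exact: measurable_powR.
  by apply: measurableT_comp; [exact: measurable_expR|exact: measurable_funN].
apply: (@le_trans _ _ (\int[lebesgue_measure]_(x in `[1%R, 2%R])
    (x `^ (a - 1) * expR (- x))%:E)%E); last first.
  apply: ge0_subset_integral => //.
  - exact: mf.
  - by move=> x _; rewrite lee_fin mulr_ge0 ?powR_ge0 ?expR_ge0.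
  - move=> x; rewrite /= !in_itv/= andbT => /andP[+ _].
    exact: lt_le_trans.
have -> : ((expR (-2) / 2)%:E = \int[lebesgue_measure]_(x in `[1%R, 2%R])
    cst (expR (-2) / 2)%:E x :> \bar R)%E.
  rewrite integral_cst//= lebesgue_measure_itv/= lte_fin ltr1n.
  by rewrite -EFinB -EFinM; congr EFin; ring.
apply: ge0_le_integral => //.
- by move=> x _; rewrite lee_fin mulr_ge0 ?expR_ge0.
- exact: mf.
move=> x /=; rewrite in_itv/= => /andP[x1 x2]; rewrite lee_fin mulrC.
have x0 : 0 < x by exact: lt_le_trans x1.
apply: ler_pM; rewrite ?expR_ge0 ?invr_ge0//; last by rewrite ler_expR lerN2.
apply: (@le_trans _ _ (x^-1)); first by rewrite lef_pV2 ?posrE.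
rewrite -(powR_inv1 (ltW x0)) ler_powR//.
by rewrite lerBrDl subrr ltW.
Qed.

(** * Euler's formulas for real arguments *)

Lemma EFin_euler_gamma (R : realType) (a : R) : 0 < a ->
  (euler_gamma a)%:E = gammaE a.
Proof.
move=> a0; rewrite /euler_gamma /Rintegral -gammaE_itv fineK//.
by rewrite ge0_fin_numE ?gammaE_lty ?gammaE_ge0.
Qed.

Lemma euler_gamma_lower_bound (R : realType) (a : R) : 0 < a ->
  expR (-2) / 2 <= euler_gamma a.
Proof.
by move=> a0; rewrite -lee_fin EFin_euler_gamma// gammaE_lower_bound.
Qed.

Lemma euler_gamma_gt0 (R : realType) (a : R) : 0 < a -> 0 < euler_gamma a.
Proof.
move=> a0; apply: lt_le_trans (euler_gamma_lower_bound a0).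
by rewrite divr_gt0 ?expR_gt0.
Qed.

Lemma euler_gammaD1 (R : realType) (a : R) : 0 < a ->
  euler_gamma (a + 1) = a * euler_gamma a.
Proof.
move=> a0; have a10 : 0 < a + 1 by rewrite addr_gt0.
apply/EFin_inj; rewrite EFinM !EFin_euler_gamma// (gammaE_recurrence a0).
by rewrite muleA -EFinM divff ?mul1e// gt_eqF.
Qed.

(** [gammaE_mul] read as an equation for the Beta integral: since
    Gamma(a+b) is positive and Gamma(a) Gamma(b) finite, it has to be finite. *)
Lemma integral_beta (R : realType) (a b t : R) : 0 < a -> 0 < b -> 0 < t ->
  (\int[lebesgue_measure]_(x in `]0%R, t[)
     (x `^ (a - 1) * (t - x) `^ (b - 1))%:E)%E =
  (t `^ (a + b - 1) * (euler_gamma a * euler_gamma b / euler_gamma (a + b)))%:E.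
Proof.
move=> a0 b0 t0; have ab0 : 0 < a + b by rewrite addr_gt0.
rewrite -betaE_itv betaE_scale tpowE// EFinM; congr (_ * _)%E.
have := gammaE_mul a b; rewrite -!EFin_euler_gamma//.
have := euler_gamma_gt0 ab0; set G := euler_gamma _ => G0.
case: (betaE a b 1) => [r| |].
- by rewrite -!EFinM => -[->]; rewrite mulrAC divff ?mul1r ?gt_eqF.
- by rewrite gt0_muley.
- by rewrite gt0_muleNy.
Qed.

(** * Wright functions with positive parameters *)

Lemma rgamma_gt0E (R : realType) (x : R) : 0 < x ->
  rgamma x = (euler_gamma x)^-1.
Proof.
move=> x0; rewrite /rgamma.
have -> : Num.truncn (1 - x) = 0%N.
  by apply/truncn0Pn; rewrite -ltNge ltrBlDr ltrDl.
by rewrite big_ord0 addr0 mul1r.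
Qed.

Lemma rgamma_gt0 (R : realType) (x : R) : 0 < x -> 0 < rgamma x.
Proof. by move=> x0; rewrite rgamma_gt0E// invr_gt0 euler_gamma_gt0. Qed.

Lemma rgammaD1 (R : realType) (x : R) : 0 < x -> x * rgamma (x + 1) = rgamma x.
Proof.
move=> x0; have x10 : 0 < x + 1 by rewrite addr_gt0.
rewrite !rgamma_gt0E// euler_gammaD1//; field.
by rewrite !gt_eqF ?euler_gamma_gt0.
Qed.

Lemma rgamma_le (R : realType) (x : R) : 0 < x ->
  rgamma x <= (expR (-2) / 2)^-1.
Proof.
move=> x0; rewrite rgamma_gt0E// lef_pV2 ?posrE ?euler_gamma_gt0//.
  exact: euler_gamma_lower_bound.
Qed.

Section wright_theory.
Variables (R : realType) (lambda : R).
Hypothesis lambda_gt0 : 0 < lambda.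
Implicit Types (mu z : R) (n : nat).

Lemma wright_arg_gt0 mu n : 0 < mu -> 0 < lambda * n%:R + mu.
Proof. by move=> mu0; rewrite ltr_wpDl// mulr_ge0// ltW. Qed.

Lemma wright_coeff_ge0 mu n : 0 < mu -> 0 <= wright_coeff lambda mu n.
Proof.
by move=> mu0; rewrite divr_ge0// ltW// rgamma_gt0// wright_arg_gt0.
Qed.

Lemma is_cvg_wright mu z : 0 < mu -> cvgn (pseries (wright_coeff lambda mu) z).
Proof.
move=> mu0; apply: normed_cvg.
pose C : R := (expR (-2) / 2)^-1.
have C0 : 0 <= C by rewrite invr_ge0 divr_ge0 ?expR_ge0.
apply: (@series_le_cvg _ _ (C *: exp_coeff `|z|)).
- by move=> n; exact: normr_ge0.
- by move=> n; rewrite mulr_ge0// /exp_coeff/= divr_ge0// exprn_ge0.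
- move=> n /=; rewrite normrM normrX (ger0_norm (wright_coeff_ge0 _ mu0)).
  rewrite /wright_coeff -mulrA.
  apply: (@le_trans _ _ (C * (n`!%:R^-1 * `|z| ^+ n))).
    rewrite ler_wpM2r ?mulr_ge0 ?invr_ge0 ?exprn_ge0//.
    exact/rgamma_le/wright_arg_gt0.
  by rewrite [n`!%:R^-1 * _]mulrC.
- apply: is_cvg_seriesZ; exact: is_cvg_series_exp_coeff.
Qed.

Lemma wright_coeff_diffs mu :
  pseries_diffs (wright_coeff lambda mu) = wright_coeff lambda (lambda + mu).
Proof.
apply/funext => n; rewrite /pseries_diffs /wright_coeff.
rewrite -natr1 mulrDr mulr1 -addrA mulrCA; congr (_ * _).
by rewrite natr1 factS natrM invfM mulrA divff ?mul1r.
Qed.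

Lemma is_derive_wright mu z : 0 < mu ->
  is_derive z 1 (wright lambda mu) (wright lambda (lambda + mu) z).
Proof.
move=> mu0.
have mu1 : 0 < lambda + mu by rewrite addr_gt0.
rewrite /wright -wright_coeff_diffs.
apply: (@pseries_snd_diffs _ _ (`|z| + 1)).
- exact: is_cvg_wright.
- by rewrite wright_coeff_diffs; exact: is_cvg_wright.
- by rewrite !wright_coeff_diffs; apply: is_cvg_wright; rewrite addr_gt0.
- by rewrite [ltRHS]ger0_norm ?addr_ge0// ltrDl.
Qed.

(** Coefficientwise this is the recurrence of Gamma,
    (lambda n + mu) / Gamma(lambda n + mu + 1) = 1 / Gamma(lambda n + mu);
    the factor n comes from z times the derivative. *)
Lemma wright_contiguous mu z : 0 < mu ->
  lambda * z * wright lambda (lambda + (mu + 1)) z +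
    mu * wright lambda (mu + 1) z = wright lambda mu z.
Proof.
move=> mu0; have mu10 : 0 < mu + 1 by rewrite addr_gt0.
set c := wright_coeff lambda (mu + 1).
have cvg1 : series (fun n => n%:R * c n * z ^+ n.-1) @ \oo -->
    wright lambda (lambda + (mu + 1)) z.
  rewrite /wright -wright_coeff_diffs; apply: pseries_diffs_equiv.
  by rewrite wright_coeff_diffs; apply: is_cvg_wright; rewrite addr_gt0.
have cvg2 : pseries c z @ \oo --> wright lambda (mu + 1) z.
  exact: is_cvg_wright.
apply/esym/cvg_lim => //.
have -> : pseries (wright_coeff lambda mu) z =
    (fun N => lambda * z * series (fun n => n%:R * c n * z ^+ n.-1) N +
      mu * pseries c z N).
  apply/funext => N; rewrite /pseries /series/= !mulr_sumr -big_split/=.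
  apply: eq_bigr => n _; rewrite /c /wright_coeff.
  rewrite -(rgammaD1 (wright_arg_gt0 n mu0)) -addrA.
  move: (rgamma _) => r; move: (n`!%:R^-1) => d.
  case: n => [|n]; first by rewrite !mulr0 !mul0r mulr0 !add0r !mulrA.
  by rewrite exprS /=; move: (n.+1%:R) (z ^+ n) => m w; ring.
exact: (cvgD (cvgM (cvg_cst (lambda * z)) cvg1) (cvgM (cvg_cst mu) cvg2)).
Qed.

End wright_theory.

(** * Differentiation and fractional integration *)

Section fractional_integral.
Variables (R : realType) (lambda : R).
Hypothesis lambda_gt0 : 0 < lambda.
Implicit Types (mu z b t k : R) (n : nat).

Lemma is_derive_wright_powR mu t : 0 < mu -> 0 < t ->
  is_derive t 1 (fun s => wright lambda mu (s `^ lambda))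
    (wright lambda (lambda + mu) (t `^ lambda) * (lambda * t `^ (lambda - 1))).
Proof.
move=> mu0 t0.
exact: is_derive1_comp (is_derive_wright lambda_gt0 _ mu0)
  (is_derive1_powR _ t0).
Qed.

(** The product rule leaves t^(mu-1) times
    lambda z W_{lambda,lambda+mu+1} + mu W_{lambda,mu+1} at z = t^lambda,
    which is the left side of the contiguous relation. *)
Lemma is_derive_powR_wright mu t : 0 < mu -> 0 < t ->
  is_derive t 1 (fun s => s `^ mu * wright lambda (mu + 1) (s `^ lambda))
    (t `^ (mu - 1) * wright lambda mu (t `^ lambda)).
Proof.
move=> mu0 t0; have mu10 : 0 < mu + 1 by rewrite addr_gt0.
apply: is_derive_eq.
  exact: is_deriveM (is_derive1_powR mu t0) (is_derive_wright_powR mu10 t0).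
rewrite -(wright_contiguous lambda_gt0 (t `^ lambda) mu0).
rewrite /GRing.scale/=.
move: (wright lambda (lambda + _) _) (wright lambda (mu + 1) _) => w1 w0.
rewrite -(mulr_powRB1 (ltW t0) mu0) -(mulr_powRB1 (ltW t0) lambda_gt0).
move: (t `^ (mu - 1)) (t `^ (lambda - 1)) => p q.
by ring.
Qed.

Lemma eseries_wright mu z k : 0 < mu ->
  (\sum_(n <oo) (k * (wright_coeff lambda mu n * z ^+ n))%:E =
   (k * wright lambda mu z)%:E)%E.
Proof.
move=> mu0; apply/cvg_lim => //.
have -> : (fun N => \sum_(0 <= n < N)
    (k * (wright_coeff lambda mu n * z ^+ n))%:E)%E =
    (fun N => (k * pseries (wright_coeff lambda mu) z N)%:E).
  by apply/funext => N; rewrite sumEFin /pseries /series/= mulr_sumr.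
have cvgW : pseries (wright_coeff lambda mu) z @ \oo --> wright lambda mu z.
  exact: is_cvg_wright.
apply: cvg_EFin; first exact: nearW.
exact: (cvgM (cvg_cst k) cvgW).
Qed.

Lemma wright_ge0 mu z : 0 < mu -> 0 <= z -> 0 <= wright lambda mu z.
Proof.
move=> mu0 z0; apply: limr_ge; first exact: is_cvg_wright.
apply: nearW => N; rewrite /pseries /series/= sumr_ge0// => n _.
by rewrite mulr_ge0 ?wright_coeff_ge0 ?exprn_ge0.
Qed.

Lemma measurable_wright mu : 0 < mu -> measurable_fun setT (wright lambda mu).
Proof.
move=> mu0; apply: continuous_measurable_fun => z.
apply: differentiable_continuous; apply/derivable1_diffP.
by have [] := is_derive_wright lambda_gt0 z mu0.
Qed.

(** The n-th term is the Beta integral with a = lambda n + mu; its factor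
    Gamma(lambda n + mu) cancels the one in the coefficient and leaves
    1 / Gamma(lambda n + mu + b), the coefficient of W_{lambda,mu+b}. *)
Lemma integral_powR_wright mu b t : 0 < mu -> 0 < b -> 0 < t ->
  (\int[lebesgue_measure]_(x in `]0%R, t[)
    (x `^ (mu - 1) * wright lambda mu (x `^ lambda) * (t - x) `^ (b - 1))%:E =
  (euler_gamma b * t `^ (mu + b - 1) * wright lambda (mu + b) (t `^ lambda))%:E
  )%E.
Proof.
move=> mu0 b0 t0.
pose u n x : R := wright_coeff lambda mu n *
  (x `^ (lambda * n%:R + mu - 1) * (t - x) `^ (b - 1)).
have powD (x : R) (a : R) n : 0 < x ->
    x `^ (lambda * n%:R + a - 1) = x `^ (a - 1) * (x `^ lambda) ^+ n.
  move=> x0; rewrite -powR_mulrn ?powR_ge0// -powRrM.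
  rewrite -powRD ?(gt_eqF x0) ?implybT//.
  by congr (_ `^ _); ring.
transitivity (\int[lebesgue_measure]_(x in `]0%R, t[)
    \sum_(n <oo) (u n x)%:E)%E.
  apply: eq_integral => x; rewrite inE/= in_itv/= => /andP[x0 xt].
  rewrite mulrAC -eseries_wright//; apply: eq_eseriesr => n _.
  by rewrite /u powD//; congr EFin; ring.
have mpow n : measurable_fun setT
    (fun x : R => x `^ (lambda * n%:R + mu - 1) * (t - x) `^ (b - 1)).
  apply: measurable_funM; first exact: measurable_powR.
  by apply: (measurableT_comp (measurable_powR _)); exact: measurable_funB.
rewrite integral_nneseries//; last 2 first.
- move=> n; apply/measurable_EFinP/measurable_funM => //.
  apply: measurable_funTS; exact: mpow.
- move=> n x _; rewrite lee_fin.
  by rewrite mulr_ge0 ?wright_coeff_ge0 ?mulr_ge0 ?powR_ge0.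
rewrite -eseries_wright ?addr_gt0//; apply: eq_eseriesr => n _.
have a0 := wright_arg_gt0 lambda_gt0 n mu0.
have ab0 : 0 < lambda * n%:R + (mu + b) by rewrite addrA addr_gt0.
under eq_integral do rewrite EFinM.
rewrite ge0_integralZl//; last 3 first.
- by apply/measurable_EFinP; apply: measurable_funTS; exact: mpow.
- by move=> x _; rewrite lee_fin mulr_ge0 ?powR_ge0.
- by rewrite lee_fin wright_coeff_ge0.
rewrite integral_beta// -EFinM; congr EFin.
rewrite -(addrA (lambda * n%:R)) powD// /wright_coeff !rgamma_gt0E//.
have := euler_gamma_gt0 a0; move: (euler_gamma _) => G G0.
move: (euler_gamma (_ + (mu + b)))^-1 (euler_gamma b) n`!%:R^-1 => H B d.
by field; rewrite gt_eqF.
Qed.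

End fractional_integral.

(** * The fractional equation *)

Theorem theorem1 (R : realType) (beta nu : R)
    (beta01 : 0 < beta < 1) (nu_ge0 : 0 <= nu) (beta_nu : 1 < beta + nu) :
  let f := fun t : R => wright beta nu (t `^ beta) in
  let g := fun t : R => t `^ nu * derive1 f t in
  forall t : R, 0 < t ->
    [/\ cvgn (pseries (wright_coeff beta nu) (t `^ beta)),
        derivable f t 1,
        caputo_derivable beta g t &
        caputo beta g t = beta * t `^ (nu - 1) * f t].
Proof.
move=> f g t t0; have /andP[b0 b1] := beta01.
have nu0 : 0 < nu by lra.
pose m := beta + nu - 1; have m0 : 0 < m by rewrite /m; lra.
have m1E : m + 1 = beta + nu by rewrite /m subrK.
have df (s : R) : 0 < s -> is_derive s 1 f
    (wright beta (beta + nu) (s `^ beta) * (beta * s `^ (beta - 1))).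
  exact: is_derive_wright_powR.
have gE (s : R) : 0 < s ->
    g s = beta * (s `^ m * wright beta (m + 1) (s `^ beta)).
  move=> s0; rewrite /g derive1E (@derive_val _ _ _ _ _ _ _ (df s s0)) m1E.
  rewrite (_ : s `^ m = s `^ nu * s `^ (beta - 1)); first by ring.
  by rewrite -powRD ?(gt_eqF s0) ?implybT// /m; congr (_ `^ _); ring.
have dg (s : R) : 0 < s -> is_derive s 1 g
    (beta * (s `^ (m - 1) * wright beta m (s `^ beta))).
  move=> s0.
  have ds := is_deriveZ beta (is_derive_powR_wright b0 m0 s0).
  apply: near_eq_is_derive ds; near=> x; apply/esym/gE.
  by near: x; exact: lt_nbhsr.
pose h (x : R) :=
  x `^ (m - 1) * wright beta m (x `^ beta) * (t - x) `^ (1 - beta - 1).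
have hE (x : R) : 0 < x < t -> caputo_integrand beta g t x = beta * h x.
  move=> /andP[x0 xt]; rewrite /caputo_integrand /h derive1E.
  rewrite (@derive_val _ _ _ _ _ _ _ (dg x x0)) -powRN.
  by rewrite (_ : 1 - beta - 1 = - beta) ?mulrA//; ring.
have mh : measurable_fun setT h.
  apply: measurable_funM.
    apply: measurable_funM; first exact: measurable_powR.
    exact: measurableT_comp (measurable_wright b0 m0) (measurable_powR _).
  by apply: (measurableT_comp (measurable_powR _)); exact: measurable_funB.
have hge0 (x : R) : 0 < x < t -> 0 <= h x.
  move=> /andP[x0 xt]; rewrite !mulr_ge0 ?powR_ge0//.
  exact: wright_ge0 (powR_ge0 _ _).
have inth : (\int[lebesgue_measure]_(x in `]0%R, t[)
      (caputo_integrand beta g t x)%:E =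
    (beta * (euler_gamma (1 - beta) * t `^ (nu - 1) * f t))%:E)%E.
  transitivity (\int[lebesgue_measure]_(x in `]0%R, t[)
      (beta%:E * (h x)%:E))%E.
    by apply: eq_integral => x; rewrite inE/= in_itv/= => /hE ->.
  rewrite ge0_integralZl//; last 2 first.
  - by apply/measurable_EFinP; exact: measurable_funTS.
  - by rewrite lee_fin ltW.
  have b'0 : 0 < 1 - beta by rewrite subr_gt0.
  have mnu : m + (1 - beta) = nu by rewrite /m; ring.
  by have := integral_powR_wright b0 m0 b'0 t0; rewrite mnu EFinM /h => ->.
split.
- exact: is_cvg_wright.
- by have [] := df t t0.
- split; first by move=> s /andP[s0 _]; have [] := dg s s0.
  apply/integrableP; split.
    apply: (@eq_measurable_fun _ _ _ _ _ (fun x => (beta * h x)%:E)).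
      by move=> x; rewrite inE/= in_itv/= => /hE ->.
    by apply/measurable_EFinP/measurable_funM => //; exact: measurable_funTS.
  under eq_integral => x.
    rewrite inE/= in_itv/= => xt; rewrite hE// ger0_norm; last first.
      by rewrite mulr_ge0 ?hge0// ltW.
    rewrite -hE//; over.
  by rewrite /= inth ltry.
- rewrite /caputo /Rintegral inth/=; field.
  by rewrite gt_eqF// euler_gamma_gt0// subr_gt0.
Unshelve. all: by end_near.
Qed.
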